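(* Let $\alpha>0$, let $A$ be an $n\times n$ nonsingular $M$-matrix, let $\overline A=I-\overline B$ be its normalization, and let $Z=(Z_1,\ldots,Z_n)=Z_{\alpha,\overline B}$ be the associated $\mathbb{N}^n$-valued random variable. Then for all ${\bf s}=(s_1,\ldots,s_n)$ with $s_i\ge 0$, $$E\left(e^{-\sum_{i=1}^{n}s_{i}Z_{i}}\right)=\frac{|\overline A|^{\alpha}}{|I-\overline B E({\bf s})|^{\alpha}},$$ where $E({\bf s})$ is the $n\times n$ diagonal matrix with diagonal entries $e^{-s_i}$, $i=1,\ldots,n$.
   Context: A real matrix $A=\{a_{i,j}\}_{1\le i,j\le n}$ is a nonsingular $M$-matrix if $a_{i,j}\le 0$ for all $i\ne j$, $A$ is nonsingular, and all entries of $A^{-1}$ are nonnegative. $|M|$ denotes the determinant of a matrix $M$. Let $a_i=a_{i,i}$ be the diagonal entries of $A$ (they are positive), let $D_A=\mathrm{diag}(a_1,\ldots,a_n)$, and write $A=D_A-B$, so $B$ has nonnegative entries and zero diagonal. Set $\overline A=D_A^{-1}A=I-\overline B$ with $\overline B=D_A^{-1}B$. For $\alpha>0$ the $\alpha$-permanent of an $n\times n$ matrix $M$ is $|M|_\alpha=\sum_{\pi}\alpha^{c(\pi)}M_{1,\pi(1)}M_{2,\pi(2)}\cdots M_{n,\pi(n)}$, where the sum is over all permutations $\pi$ of $\{1,\ldots,n\}$ and $c(\pi)$ is the number of cycles of $\pi$. $\mathbb{N}=\{0,1,2,\ldots\}$. For ${\bf k}=(k_1,\ldots,k_n)\in\mathbb{N}^n$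 put $|{\bf k}|=\sum_l k_l$, and for $1\le m\le|{\bf k}|$ let $i_m=j$ where $j$ is determined by $\sum_{l=1}^{j-1}k_l<m\le\sum_{l=1}^{j}k_l$. For an $n\times n$ matrix $C=\{c_{i,j}\}$, $C({\bf k})$ is the $|{\bf k}|\times|{\bf k}|$ matrix with $(p,q)$ entry $c_{i_p,i_q}$; by convention $|C({\bf 0})|_\alpha=1$. $Z=Z_{\alpha,\overline B}$ is an $\mathbb{N}^n$-valued random variable with distribution $P(Z=(k_1,\ldots,k_n))=|\overline A|^{\alpha}\,\dfrac{|\overline B({\bf k})|_\alpha}{\prod_{i=1}^n k_i!}$ (these probabilities sum to 1). *)

(* Defs.v *)
From HB Require Import structures.
From mathcomp Require Import all_boot all_order all_algebra perm.
From mathcomp Require Import all_classical all_reals all_analysis.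

Set Implicit Arguments.
Unset Strict Implicit.
Unset Printing Implicit Defensive.

Import Order.TTheory GRing.Theory Num.Theory.
Import numFieldNormedType.Exports.

Local Open Scope ring_scope.

Section MMatrix.
Variables (R : realType) (n : nat).
Implicit Types A : 'M[R]_n.

Definition nonsingular_Mmatrix A : Prop :=
  [/\ forall i j, i != j -> A i j <= 0,
      A \in unitmx
    & forall i j, 0 <= invmx A i j].

Definition diag_part A : 'M[R]_n := diag_mx (\row_i A i i).

Definition off_part A : 'M[R]_n := diag_part A - A.

(* The diagonal of a nonsingular M-matrix is positive, so that the inverse
   below is a genuine one. *)
Definition normalize A : 'M[R]_n := invmx (diag_part A) *m A.

Definition normalize_off A : 'M[R]_n := invmx (diag_part A) *m off_part A.

End MMatrix.

(* For [n = 0] the only permutation has no cycle, so the value is 1. *)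
Definition alpha_perm (R : realType) (alpha : R) n (M : 'M[R]_n) : R :=
  \sum_(s : 'S_n) alpha ^+ #|porbits s| * \prod_i M i (s i).

(* [block_index k m] is the block containing [m] when {0, ..., |k| - 1} is cut
   into consecutive intervals of lengths k_0, ..., k_(n-1); see
   [block_indexP]. *)
Definition block_index n (k : n.-tuple nat) :
    'I_(\sum_i tnth k i) -> 'I_n :=
  @tagnat.sig1 n (tnth k).

Lemma block_indexP n (k : n.-tuple nat) (m : 'I_(\sum_i tnth k i)) (j : 'I_n) :
  (block_index m = j) <->
  (\sum_(l < n | (l < j)%N) tnth k l <= m
     < \sum_(l < n | (l <= j)%N) tnth k l)%N.
Proof.
have incl (p : 'I_n) : (\sum_(l < n | (l <= p)%N) tnth k l =
    \sum_(l < n | (l < p)%N) tnth k l + tnth k p)%N.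
  rewrite (bigD1 p) //= addnC; congr addn.
  by apply: eq_bigl => l; rewrite [RHS]ltn_neqAle andbC.
have mono (p q : 'I_n) : (p < q)%N ->
    (\sum_(l < n | (l <= p)%N) tnth k l <= \sum_(l < n | (l < q)%N) tnth k l)%N.
  move=> pq; rewrite [leqRHS](bigID (fun l : 'I_n => (l <= p)%N)) /=.
  rewrite [X in (_ <= X + _)%N](_ : _ = \sum_(l < n | (l <= p)%N) tnth k l)%N.
    exact: leq_addr.
  apply: eq_bigl => l; apply/andP/idP => [[]//|lp].
  by rewrite (leq_ltn_trans lp pq).
have bounds : (\sum_(l < n | (l < block_index m)%N) tnth k l <= m
    < \sum_(l < n | (l <= block_index m)%N) tnth k l)%N.
  rewrite incl; have := tagnat.rect m.
  rewrite -[tagnat.sig1 m]/(block_index m) => e; apply/andP; split.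
    by rewrite [leqRHS]e leq_addr.
  by rewrite [ltnLHS]e ltn_add2l ltn_ord.
split=> [<-|/andP[jm mj]]; first exact: bounds.
move: bounds => /andP[bm mb].
case: (ltngtP (block_index m) j) => [lt|gt|]; last exact: val_inj.
- by have := leq_ltn_trans (leq_trans (mono _ _ lt) jm) mb; rewrite ltnn.
- by have := leq_ltn_trans (leq_trans (mono _ _ gt) bm) mj; rewrite ltnn.
Qed.

Definition blowup (R : realType) n (C : 'M[R]_n) (k : n.-tuple nat) :
    'M[R]_(\sum_i tnth k i) :=
  \matrix_(p, q) C (block_index p) (block_index q).

Definition Z_mass (R : realType) n (alpha : R) (A : 'M[R]_n)
    (k : n.-tuple nat) : R :=
  (\det (normalize A)) `^ alpha *
  (alpha_perm alpha (blowup (normalize_off A) k) / \prod_i ((tnth k i)`!)%:R).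

Definition exp_diag (R : realType) n (s : 'I_n -> R) : 'M[R]_n :=
  diag_mx (\row_i expR (- s i)).

(* Main.v *)
Require Import Defs.
From HB Require Import structures.
From mathcomp Require Import all_boot all_order all_algebra perm.
From mathcomp Require Import all_classical all_reals all_analysis.
From mathcomp Require Import measurable_realfun ring lra zify.

(** Let C be the matrix Bbar E(s).  Since E(s) multiplies the columns of Bbar, the
Laplace transform is |Abar|^alpha times the sum over k of
|C(k)|_alpha / prod k_i!, so the point is the identity

      sum_k |C(k)|_alpha / prod k_i! = |I - C|^(-alpha)                    (1)

for nonnegative C whenever the left side converges (alpha_perm_master).

Collect in (1) the multi-indices k with |k| = N.  A multi-index k is the
histogram of N! / prod k_i! words of length N over {1, ..., n}, hence the group
sums to g_N = (1 / N!) sum_t |C(t)|_alpha over all words t of length N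
(alpha_coef_levels).  Deleting one point of a permutation from its cycle either
loses a fixed point, which costs a factor alpha and a trace, or shortens a cycle
and merges two consecutive matrix factors into their product; iterating this
gives (alpha_coef_rec)

      (N + 1) g_(N+1) = alpha sum_(i <= N) tr(C^(i+1)) g_(N-i).            (2)

With T = sum_i tr(C^(i+1)) x^i and G = sum_N g_N x^N this says G' = alpha T G as
formal power series, while Jacobi's formula gives D' = - T D for the polynomial
D = |I - x C| (coef_deriv_fredholm).  So D G' + alpha D' G = 0 formally, that
is, G D^alpha is constant, and evaluation at x = 1 is (1).

To evaluate without differentiating a power series at the end of its interval of
convergence, G is truncated at degree M.  All the coefficients of
D G' + alpha D' G below degree M still vanish, and the remaining ones are at
most of the order of M times the sum of the last few g_N; the factor M is
absorbed by integrating t^M (norm_wronsk_trunc, log_estimate).  Therefore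
ln G_M(x) + alpha ln D(x) tends to 0 for x up to and including 1, as long as D
is positive on [0, x].  As G_M is bounded by the sum of all the g_N, this limit
also bounds D below by a positive constant wherever it applies, so D never
vanishes on [0, 1] (fredholm_gt0).

The convergence needed in (1) comes from probability: for s = 0 the left side
is the total mass 1 of Z divided by |Abar|^alpha, and for s >= 0 the
coefficients are dominated by those for s = 0.  The M-matrix property enters
through the signs of the entries of Bbar. *)

Set Implicit Arguments.
Unset Strict Implicit.
Unset Printing Implicit Defensive.

Import Order.TTheory GRing.Theory Num.Theory.
Import numFieldNormedType.Exports.

Local Open Scope ring_scope.

(** * Removing a point from a permutation *)

(** Used twice: for the conjugation of a permutation, and for
the embedding of the orbits of s into those of its extension by a fixed point. *)
Lemma porbit_equivariant (T T' : finType) (f : T -> T') (s : {perm T})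
    (s' : {perm T'}) :
  (forall x, f (s x) = s' (f x)) ->
  forall x, porbit s' (f x) = f @: porbit s x.
Proof.
move=> fs x.
have fsX i : f ((s ^+ i)%g x) = (s' ^+ i)%g (f x).
  elim: i => [|i IHi]; first by rewrite !expg0 !perm1.
  by rewrite !expgSr !permM fs IHi.
apply/setP => y; apply/porbitP/imsetP => [[i ->]|[z /porbitP[i ->] ->]].
  by exists ((s ^+ i)%g x); rewrite ?mem_porbit.
by exists i.
Qed.

Lemma card_porbitsJ (T : finType) (s t : {perm T}) :
  #|porbits (s ^ t)%g| = #|porbits s|.
Proof.
have E x : t (s x) = (s ^ t)%g (t x) by rewrite permJ.
suff -> : porbits (s ^ t)%g = (fun B : {set T} => t @: B) @: porbits s.
  by rewrite card_imset //; apply: imset_inj; apply: perm_inj.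
apply/setP => B; apply/imsetP/imsetP => [[x _ ->]|[_ /imsetP[x _ ->] ->]].
  exists (porbit s (t^-1%g x)); first exact: imset_f.
  by rewrite -(porbit_equivariant E) permKV.
by exists (t x); rewrite // (porbit_equivariant E).
Qed.

Lemma card_porbits_lift0 n (s : 'S_n) :
  #|porbits (lift_perm ord0 ord0 s)| = #|porbits s|.+1.
Proof.
set s0 := lift_perm _ _ s.
have E x : lift ord0 (s x) = s0 (lift ord0 x) by rewrite /s0 lift_perm_lift.
have P0 : porbit s0 ord0 = [set ord0].
  apply/setP => y; rewrite inE; apply/porbitP/eqP => [[i ->]|->].
    by elim: i => [|i IHi]; rewrite ?perm1 // expgSr permM IHi lift_perm_id.
  by exists 0%N; rewrite perm1.
have -> : porbits s0 =
    [set ord0] |: (fun B : {set 'I_n} => lift ord0 @: B) @: porbits s.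
  apply/setP => B; rewrite in_setU1; apply/imsetP/orP.
    move=> [x _ ->]; case: (unliftP ord0 x) => [j ->|->]; last by left; apply/eqP.
    by right; rewrite (porbit_equivariant E) !imset_f.
  case=> [/eqP->|/imsetP[_ /imsetP[x _ ->] ->]]; first by exists ord0.
  by exists (lift ord0 x); rewrite // (porbit_equivariant E).
rewrite cardsU1 card_imset; last by apply: imset_inj; apply: lift_inj.
case: imsetP => // -[B _ /setP/(_ ord0)]; rewrite inE eqxx => /esym/imsetP[x _].
by move/eqP; rewrite (negPf (neq_lift _ _)).
Qed.

(** For j = 0 this is s with 0 added as a fixed point; for j = j' + 1
it is s with 0 inserted into the cycle of j', between j' and s j'. *)
Definition insert0 n (js : 'I_n.+1 * 'S_n) : 'S_n.+1 :=
  (tperm ord0 js.1 * lift_perm ord0 ord0 js.2)%g.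

(** The point j is recovered as the preimage of 0; both sides have
(n + 1)! elements, so injectivity is enough. *)
Lemma insert0_bij n : bijective (@insert0 n).
Proof.
have inj : injective (@insert0 n).
  move=> [j s] [j' s']; rewrite /insert0 /= => e.
  have ej : j = j'.
    have : (tperm ord0 j * lift_perm ord0 ord0 s)%g j = ord0.
      by rewrite permM tpermR lift_perm_id.
    rewrite e permM -[in RHS](lift_perm_id ord0 ord0 s') => /perm_inj.
    by move/(congr1 (tperm ord0 j')); rewrite tpermK tpermL.
  move: e; rewrite ej => /mulgI e; congr (_, _).
  apply/permP => i; apply: (@lift_inj _ ord0).
  by rewrite -(lift_perm_lift ord0 ord0 s) e lift_perm_lift.
apply: inj_card_bij inj _.
by rewrite card_prod !card_Sn card_ord factS.
Qed.

(** Multiplying by a transposition of points in different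
cycles merges these two cycles, and 0 is alone in its cycle before that. *)
Lemma card_porbits_insert0 n (js : 'I_n.+1 * 'S_n) :
  #|porbits (insert0 js)| = ((js.1 == ord0) + #|porbits js.2|)%N.
Proof.
case: js => j s; have := porbits_mul_tperm (lift_perm ord0 ord0 s) ord0 j.
rewrite /insert0 /= card_porbits_lift0.
case: (eqVneq j ord0) => [->|jn0].
  by rewrite porbit_id /= !addn0 => ->.
have -> : ord0 \notin porbit (lift_perm ord0 ord0 s) j.
  apply/negP; rewrite porbit_sym => /porbitP[i ji]; move: jn0.
  rewrite ji => /negP; apply; apply/eqP.
  by elim: i {ji} => [|i IHi]; rewrite ?perm1 // expgSr permM IHi lift_perm_id.
by rewrite /= addn1 addn2 add0n => -[].
Qed.

Section AlphaPerm.
Variables (R : realType) (alpha : R).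

Lemma alpha_perm_conj n (M : 'M[R]_n) (t : 'S_n) :
  alpha_perm alpha (\matrix_(p, q) M (t p) (t q)) = alpha_perm alpha M.
Proof.
rewrite /alpha_perm [RHS](reindex_inj (@conjg_inj _ t)) /=.
apply: eq_bigr => s _; rewrite card_porbitsJ; congr (_ * _).
rewrite [RHS](reindex_inj (@perm_inj _ t)) /=.
by apply: eq_bigr => i _; rewrite mxE permJ.
Qed.

(** Sort the permutations by the preimage of 0.  If it is 0, the
cycle (0) contributes a factor alpha.  If it is j, bypassing 0 replaces the path
j -> 0 -> q by a step j -> q whose weight is the product of the two entries. *)
Lemma alpha_perm_rec n (M : 'M[R]_n.+1) :
  alpha_perm alpha M =
  alpha * M ord0 ord0 *
    alpha_perm alpha (\matrix_(p, q) M (lift ord0 p) (lift ord0 q)) +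
  \sum_(j < n) alpha_perm alpha
    (\matrix_(p, q) if p == j then M (lift ord0 j) ord0 * M ord0 (lift ord0 q)
                    else M (lift ord0 p) (lift ord0 q)).
Proof.
rewrite {1}/alpha_perm (reindex (@insert0 n)); last exact/onW_bij/insert0_bij.
rewrite -(pair_bigA _ (fun j s => alpha ^+ #|porbits (insert0 (j, s))| *
  \prod_i M i (insert0 (j, s) i))) /=.
rewrite big_ord_recl; congr (_ + _).
  rewrite /alpha_perm big_distrr /=; apply: eq_bigr => s _.
  rewrite card_porbits_insert0 /= exprS big_ord_recl /insert0 /= tperm1 mul1g.
  rewrite lift_perm_id -!mulrA; congr (_ * _); rewrite mulrCA.
  congr (_ * (_ * _)); apply: eq_bigr => i _.
  by rewrite mxE lift_perm_lift.
apply: eq_bigr => j _; rewrite /alpha_perm; apply: eq_bigr => s _.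
rewrite card_porbits_insert0 /=; congr (_ * _).
rewrite big_ord_recl (bigD1 j) //= [RHS](bigD1 j) //= mxE eqxx mulrA.
rewrite /insert0 /= permM tpermL lift_perm_lift permM tpermR lift_perm_id.
rewrite mulrC [M ord0 _ * _]mulrC mulrC; congr (_ * _).
apply: eq_bigr => i ij; rewrite mxE (negPf ij) permM tpermD ?lift_perm_lift //.
by rewrite (inj_eq (@lift_inj _ _)) eq_sym.
Qed.

End AlphaPerm.

(** * Traces of powers and the coefficient recursion *)

Lemma big_tuple_cons (V : nmodType) (T : finType) N (F : N.+1.-tuple T -> V) :
  \sum_t F t = \sum_a \sum_(t : N.-tuple T) F (cons_tuple a t).
Proof.
rewrite pair_bigA /= (reindex (fun u : T * N.-tuple T => cons_tuple u.1 u.2)) //=.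
exists (fun t : N.+1.-tuple T => (thead t, behead_tuple t)) => [[a t]|t] _ /=.
  by congr (_, _); apply: val_inj.
by rewrite [in RHS](tuple_eta t); apply: val_inj.
Qed.

Section Words.
Variables (R : realType) (alpha : R).

Lemma alpha_perm_sum_row N (I : finType) (M : 'M[R]_N) j (v : I -> 'I_N -> R) :
  alpha_perm alpha
    (\matrix_(p, q) if p == j then \sum_a v a q else M p q) =
  \sum_a alpha_perm alpha (\matrix_(p, q) if p == j then v a q else M p q).
Proof.
rewrite /alpha_perm exchange_big /=; apply: eq_bigr => s _.
rewrite -big_distrr /=; congr (_ * _).
rewrite (bigD1 j) //= mxE eqxx mulr_suml; apply: eq_bigr => a _.
rewrite [RHS](bigD1 j) //= mxE eqxx; congr (_ * _).
by apply: eq_bigr => p pj; rewrite !mxE (negPf pj).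
Qed.

Variable n : nat.

(** The alpha-permanents of all the words of length N, with one matrix
attached to each position: the extra freedom is what makes the removal of a
position stay within the same family of sums. *)
Definition word_sum N (Ms : 'I_N -> 'M[R]_n) : R :=
  \sum_(t : N.-tuple 'I_n)
    alpha_perm alpha (\matrix_(p, q) Ms p (tnth t p) (tnth t q)).

Lemma eq_wordsum N (Ms Ms' : 'I_N -> 'M[R]_n) :
  Ms =1 Ms' -> word_sum Ms = word_sum Ms'.
Proof.
by move=> e; congr word_sum; apply: funext.
Qed.

Lemma word_sum_perm N (Ms : 'I_N -> 'M[R]_n) (s : 'S_N) :
  word_sum (Ms \o s) = word_sum Ms.
Proof.
rewrite /word_sum.
rewrite (reindex (fun t : N.-tuple 'I_n => [tuple tnth t (s i) | i < N])) /=.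
  apply: eq_bigr => t _; rewrite -[RHS](alpha_perm_conj _ _ s).
  by congr alpha_perm; apply/matrixP => p q; rewrite !mxE /= !tnth_mktuple.
exists (fun t : N.-tuple 'I_n => [tuple tnth t (s^-1%g i) | i < N]) => t _;
  by apply: eq_from_tnth => i; rewrite !tnth_mktuple ?permK ?permKV.
Qed.

(** alpha_perm_rec summed over the letter at position 0: the fixed
points of the permutation produce a trace, the bypassed steps a matrix product. *)
Lemma word_sum_rec N (Ms : 'I_N.+1 -> 'M[R]_n) :
  word_sum Ms =
  alpha * \tr (Ms ord0) * word_sum (Ms \o lift ord0) +
  \sum_(j < N) word_sum (fun p => if p == j then Ms (lift ord0 j) *m Ms ord0
                                 else Ms (lift ord0 p)).
Proof.
rewrite /word_sum big_tuple_cons.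
under eq_bigr => a _ do
  (under eq_bigr => t _ do rewrite alpha_perm_rec mxE /=; rewrite big_split /=).
rewrite big_split /=; congr (_ + _).
  rewrite /mxtrace -mulrA mulr_suml mulr_sumr; apply: eq_bigr => a _.
  rewrite mulrA mulr_sumr; apply: eq_bigr => t _; rewrite !tnth0.
  by congr (_ * alpha_perm _ _); apply/matrixP => p q; rewrite !mxE !tnthS.
under eq_bigr => a _ do rewrite exchange_big /=.
rewrite exchange_big /=; apply: eq_bigr => j _.
rewrite exchange_big /=; apply: eq_bigr => t _.
pose v a q := Ms (lift ord0 j) (tnth t j) a * Ms ord0 a (tnth t q).
pose M := \matrix_(p, q) Ms (lift ord0 p) (tnth t p) (tnth t q).
transitivity (\sum_a alpha_perm alpha (\matrix_(p, q) if p == j then v a q else M p q)).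
  apply: eq_bigr => a _; congr alpha_perm; apply/matrixP => p q.
  by rewrite !mxE !tnthS !tnth0.
rewrite -alpha_perm_sum_row; congr alpha_perm; apply/matrixP => p q.
by rewrite !mxE; case: eqP => // ->; rewrite mxE.
Qed.

Variable C : 'M[R]_n.

(** The coefficient of x^N in the formal power series
det (1 - x C) ^ (- alpha). *)
Definition alpha_coef N : R := word_sum (fun _ : 'I_N => C) / N`!%:R.

Let u N m := word_sum (fun p : 'I_N.+1 => if p == ord0 then C ^+ m else C) / N`!%:R.

(** Removing position 0, which carries C^m, leaves a word sum
where some position carries C^(m+1); by symmetry it may be taken to be 0. *)
Lemma word_sum_rec_pow N m :
  u N m = alpha * \tr (C ^+ m) * alpha_coef N + (if N is N'.+1 then u N' m.+1 else 0).
Proof.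
rewrite /u word_sum_rec /= mulrDl -mulrA; congr (_ + _); case: N => [|N].
  by rewrite big_ord0 mul0r.
transitivity (\sum_(j < N.+1)
    word_sum (fun p : 'I_N.+1 => if p == ord0 then C ^+ m.+1 else C) / N.+1`!%:R).
  rewrite mulr_suml; apply: eq_bigr => j _; congr (_ / _).
  rewrite -[RHS](word_sum_perm _ (tperm ord0 j)); apply: eq_wordsum => p /=.
  rewrite -[X in tperm _ _ _ == X](tpermR ord0 j) (inj_eq perm_inj).
  by rewrite exprS.
rewrite sumr_const card_ord factS natrM invfM -[LHS]mulr_natl mulrCA.
by rewrite mulVKf // pnatr_eq0.
Qed.

Lemma alpha_coef0 : alpha_coef 0 = 1.
Proof.
rewrite /alpha_coef /word_sum divr1 (big_pred1 [tuple]) => [|t]; last first.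
  by rewrite [t]tuple0 /=; apply/esym/eqP.
rewrite /alpha_perm (big_pred1 (1%g : 'S_0)) => [|s]; last first.
  by rewrite [s]permS0 /=; apply/esym/eqP.
rewrite big_ord0 mulr1 (_ : porbits _ = finset.set0) ?cards0 ?expr0 //.
by apply/setP => B; rewrite inE; apply/imsetP => -[[]].
Qed.

(** The coefficients of G' = alpha T G, where G is the generating
series of alpha_coef and T that of the traces of the powers of C. *)
Lemma alpha_coef_rec N :
  N.+1%:R * alpha_coef N.+1 =
  alpha * \sum_(i < N.+1) \tr (C ^+ i.+1) * alpha_coef (N - i).
Proof.
have -> : N.+1%:R * alpha_coef N.+1 = u N 1.
  rewrite /alpha_coef /u factS natrM invfM mulrCA.
  rewrite (_ : word_sum (fun=> C) = word_sum (fun p : 'I_N.+1 =>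
    if p == ord0 then C ^+ 1 else C)).
    by rewrite mulVKf // pnatr_eq0.
  by apply: eq_wordsum => p; rewrite expr1 if_same.
transitivity (alpha * \sum_(i < N.+1) \tr (C ^+ (1 + i)) * alpha_coef (N - i)) => //.
elim: N (1%N) => [|N IHN] m.
  by rewrite word_sum_rec_pow addr0 big_ord_recl big_ord0 !addr0 addn0 mulrA.
rewrite word_sum_rec_pow IHN [in RHS]big_ord_recl mulrDr addn0 subn0 -mulrA.
congr (_ + _ * _); by apply: eq_bigr => i _; rewrite addnS addSn subSS.
Qed.

End Words.

(** * Jacobi's formula for det (1 - X C) *)

Lemma deriv_prod_ord (R : comNzRingType) n (f : 'I_n -> {poly R}) :
  (\prod_i f i)^`() = \sum_i \prod_j (if j == i then (f j)^`() else f j).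
Proof.
elim: n f => [|n IHn] f; first by rewrite !big_ord0 -[1]/(1%:P) derivC.
rewrite !big_ord_recl derivM IHn mulr_sumr eqxx; congr (_ * _ + _).
apply: eq_bigr => i _; by rewrite big_ord_recl.
Qed.

(** The product rule differentiates one row at a time, and each of the
resulting determinants is expanded along that row. *)
Lemma deriv_det (R : comNzRingType) n (M : 'M[{poly R}]_n) :
  (\det M)^`() = \sum_i \sum_j (M i j)^`() * cofactor M i j.
Proof.
pose M' i := \matrix_(p, q) if p == i then (M p q)^`() else M p q.
transitivity (\sum_i \det (M' i)).
  rewrite /determinant raddf_sum exchange_big /=; apply: eq_bigr => s _.
  rewrite -mulr_sumr -signr_odd /=.
  have -> : (-1) ^+ odd s = ((-1) ^+ odd s)%:P :> {poly R}.
    by rewrite rmorphXn /= rmorphN1.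
  rewrite deriv_mulC deriv_prod_ord; congr (_ * _); apply: eq_bigr => i _.
  by apply: eq_bigr => j _; rewrite mxE; case: eqP => // ->.
apply: eq_bigr => i _; rewrite (expand_det_row _ i); apply: eq_bigr => j _.
rewrite mxE eqxx; congr (_ * (_ * \det _)); apply/matrixP => p q.
by rewrite !mxE eq_sym (negPf (neq_lift _ _)).
Qed.

Section Fredholm.
Variables (R : comNzRingType) (n : nat) (C : 'M[R]_n).

Let Cp : 'M[{poly R}]_n := map_mx polyC C.
Let M := 1%:M - 'X *: Cp.

(** The polynomial det (1 - X C), the reverse of the characteristic
polynomial of C. *)
Definition fredholm : {poly R} := \det M.

Lemma horner_fredholm x : fredholm.[x] = \det (1%:M - x *: C).
Proof.
rewrite -[LHS]/(horner_eval x fredholm) /fredholm -det_map_mx; congr (\det _).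
apply/matrixP => i j; rewrite !mxE /= /horner_eval.
by rewrite hornerD hornerN hornerM hornerX hornerC hornerMn hornerC.
Qed.

Let p m := \tr (map_mx polyC (C ^+ m) *m \adj M).

Lemma deriv_fredholm : fredholm^`() = - p 1.
Proof.
rewrite deriv_det /p expr1 /mxtrace -sumrN; apply: eq_bigr => i _.
rewrite mxE -sumrN; apply: eq_bigr => j _; rewrite !mxE.
rewrite derivB derivM derivX derivC mulr0 addr0 mul1r -mulNr; congr (_ * _).
by rewrite derivMn -[1]/(1%:P) derivC mul0rn sub0r.
Qed.

(** From adj M = (det M) 1 + X C adj M for M = 1 - X C. *)
Lemma fredholm_trace m : p m = fredholm * (\tr (C ^+ m))%:P + 'X * p m.+1.
Proof.
have adjE : \adj M = fredholm%:M + 'X *: (Cp *m \adj M).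
  by rewrite -mul_mx_adj mulmxBl mul1mx scalemxAl subrK.
rewrite {1}/p adjE mulmxDr mxtraceD -scalemxAr mxtraceZ mulmxA.
rewrite mul_mx_scalar mxtraceZ; congr (_ * _ + _ * _).
  by rewrite /mxtrace rmorph_sum; apply: eq_bigr => i _; rewrite mxE.
by rewrite -map_mxM /p exprSr.
Qed.

(** Newton's identities for the power sums tr (C^k), as the
congruence D' = - D T modulo X^N: unfold fredholm_trace N times in
D' = - tr (C adj (1 - X C)). *)
Lemma coef_deriv_fredholm N i : (i < N)%N ->
  fredholm^`()`_i = - (fredholm * \poly_(k < N) \tr (C ^+ k.+1))`_i.
Proof.
move=> iN; rewrite deriv_fredholm coefN; congr (- _).
have -> : p 1 = fredholm * \poly_(k < N) \tr (C ^+ k.+1) + 'X^N * p N.+1.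
  elim: {i iN} N => [|N IHN]; first by rewrite poly_def big_ord0 mulr0 add0r mul1r.
  rewrite IHN fredholm_trace !poly_def big_ord_recr /= mulrDr mulrDr -!addrA.
  by congr (_ + _); rewrite -mul_polyC (exprSr (polyX R)); ring.
by rewrite coefD coefXnM iN addr0.
Qed.

End Fredholm.

(** * Weighted truncation of a formal logarithmic derivative *)

Section Norm1.
Variable R : realFieldType.
Implicit Types p q : {poly R}.

Definition norm1 p : R := \sum_(i < size p) `|p`_i|.

Lemma norm1_ge0 p : 0 <= norm1 p.
Proof. by apply: sumr_ge0. Qed.

Lemma norm1_wide m p : (size p <= m)%N -> norm1 p = \sum_(i < m) `|p`_i|.
Proof.
move=> pm; rewrite /norm1 (big_ord_widen _ (fun i => `|p`_i|) pm).
rewrite [RHS](bigID (fun i : 'I_m => (i < size p)%N)) /=.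
rewrite [X in _ = _ + X]big1 ?addr0 // => i; rewrite -leqNgt => pi.
by rewrite nth_default // normr0.
Qed.

Lemma norm1D p q : norm1 (p + q) <= norm1 p + norm1 q.
Proof.
pose m := maxn (size p) (size q).
rewrite (@norm1_wide m) ?size_polyD // (@norm1_wide m p) ?leq_maxl //.
rewrite (@norm1_wide m q) ?leq_maxr // -big_split /=.
by apply: ler_sum => i _; rewrite coefD ler_normD.
Qed.

Lemma norm1Z c p : norm1 (c *: p) <= `|c| * norm1 p.
Proof.
rewrite (norm1_wide (size_scale_leq c p)) /norm1 mulr_sumr.
by apply: ler_sum => i _; rewrite coefZ normrM.
Qed.

Lemma norm1M p q : norm1 (p * q) <= norm1 p * norm1 q.
Proof.
pose np (r : {poly R}) : {poly R} := \poly_(i < size r) `|r`_i|.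
have npE (r : {poly R}) i : (np r)`_i = `|r`_i|.
  rewrite coef_poly; case: ltnP => // ri.
  by rewrite nth_default // normr0.
have np1 r : (np r).[1] = norm1 r.
  rewrite (horner_coef_wide _ (size_poly _ _)) /norm1; apply: eq_bigr => i _.
  by rewrite npE expr1n mulr1.
rewrite -!np1 -hornerM; pose m := (size p + size q + size (np p * np q)%R)%N.
rewrite np1 (@norm1_wide m); last first.
  rewrite (leq_trans (size_polyMleq _ _)) // (leq_trans (leq_pred _)) //.
  exact: leq_addr.
rewrite (@horner_coef_wide _ m) ?leq_addl //.
apply: ler_sum => i _; rewrite expr1n mulr1 !coefM.
apply: le_trans (ler_norm_sum _ _ _) _.
by apply: ler_sum => j _; rewrite !npE normrM.
Qed.

Lemma norm1_deriv p : norm1 p^`() <= (size p)%:R * norm1 p.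
Proof.
case E : (size p) => [|m].
  by rewrite mul0r; move/eqP: E; rewrite size_poly_eq0 => /eqP ->;
     rewrite deriv0 /norm1 size_poly0 big_ord0.
rewrite (@norm1_wide m p^`()); last first.
  by rewrite -ltnS -E; apply: leq_trans (lt_size_deriv _) _; rewrite -?size_poly_eq0 E.
rewrite /norm1 E big_ord_recl mulrDr ler_wpDl ?mulr_ge0 // mulr_sumr.
apply: ler_sum => i _; rewrite coef_deriv normrMn -[leLHS]mulr_natl lift0.
by rewrite ler_wpM2r // ler_nat; apply: leq_trans (ltn_ord i) _.
Qed.

(** The polynomial q stands for p with its low coefficients
altered: it is easier to bound than p when those of p cancel. *)
Lemma norm_horner_tail M p q (t : R) :
  (forall i, (i < M)%N -> p`_i = 0) -> (forall i, (M <= i)%N -> p`_i = q`_i) ->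
  0 <= t <= 1 -> `|p.[t]| <= norm1 q * t ^+ M.
Proof.
move=> p0 pq /andP[t0 t1]; pose m := maxn (size p) (size q).
rewrite (@horner_coef_wide _ m) ?leq_maxl // (@norm1_wide m) ?leq_maxr //.
rewrite mulr_suml; apply: le_trans (ler_norm_sum _ _ _) _.
apply: ler_sum => i _; rewrite normrM.
have [iM|Mi] := ltnP i M; first by rewrite p0 // normr0 mul0r mulr_ge0 ?exprn_ge0.
by rewrite pq // ler_wpM2l // ger0_norm ?exprn_ge0 // ler_wiXn2l.
Qed.

Lemma coefM_congr p q r M : (forall i, (i < M)%N -> p`_i = q`_i) ->
  forall i, (i < M)%N -> (r * p)`_i = (r * q)`_i.
Proof.
move=> pq i iM; rewrite !coefM; apply: eq_bigr => j _; rewrite pq //.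
by rewrite (leq_ltn_trans _ iM) // leq_subr.
Qed.

End Norm1.

Section LogDerivative.
Variables (R : realFieldType) (alpha : R) (D : {poly R}) (g tau : nat -> R).
Hypothesis alpha_ge0 : 0 <= alpha.
Hypothesis g_ge0 : forall i, 0 <= g i.
Hypothesis g_rec : forall N,
  N.+1%:R * g N.+1 = alpha * \sum_(i < N.+1) tau i * g (N - i)%N.
Hypothesis D_rec : forall N i, (i < N)%N ->
  D^`()`_i = - (D * \poly_(k < N) tau k)`_i.

Definition trunc M : {poly R} := \poly_(i < M.+1) g i.

(** D^(1 - alpha) times the derivative of D^alpha G. *)
Definition wronsk (G : {poly R}) := D * G^`() + alpha *: (D^`() * G).

Lemma wronskD G H : wronsk (G + H) = wronsk G + wronsk H.
Proof.
by rewrite /wronsk derivD !mulrDr scalerDr addrACA.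
Qed.

(** Modulo X^M the hypotheses say G' = alpha T G and D' = - D T,
and then D G' + alpha D' G = alpha D T G - alpha D T G. *)
Lemma coef_wronsk_trunc M i : (i < M)%N -> (wronsk (trunc M))`_i = 0.
Proof.
move=> iM; pose T := \poly_(k < M) tau k.
have dG j : (j < M)%N -> (trunc M)^`()`_j = (alpha *: (T * trunc M))`_j.
  move=> jM; rewrite coef_deriv coef_poly ltnS jM -mulr_natl g_rec coefZ coefM.
  congr (_ * _); apply: eq_bigr => k _; rewrite !coef_poly.
  have kM : (k < M)%N by apply: leq_ltn_trans jM; rewrite -ltnS.
  by rewrite kM ltnS (leq_trans (leq_subr _ _)) // ltnW.
have dD j : (j < M)%N -> D^`()`_j = (- (D * T))`_j.
  by move=> jM; rewrite coefN -D_rec.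
rewrite coefD coefZ (coefM_congr _ dG iM) [D^`() * _]mulrC (coefM_congr _ dD iM).
rewrite -coefZ -coefD -!mul_polyC.
rewrite (_ : D * _ + _ = 0) ?coef0 //; ring.
Qed.

Let d := size D.

(** The top size D terms of the truncation.  Below them D G' + alpha D' G
has degree less than M, so they alone account for the coefficients that do not
cancel. *)
Definition last_block M : {poly R} :=
  \poly_(i < M.+1) (if (M - d < i)%N then g i else 0).

Lemma trunc_split M : trunc M = trunc (M - d) + last_block M.
Proof.
apply/polyP => i; rewrite coefD !coef_poly !ltnS.
have [iMd|Mdi] := leqP i (M - d); last by rewrite add0r; case: leqP.
by rewrite (leq_trans iMd (leq_subr _ _)) addr0.
Qed.

Definition last_sum M := \sum_(i < M.+1) g i - \sum_(i < (M - d).+1) g i.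

Lemma norm1_last_block M : norm1 (last_block M) = last_sum M.
Proof.
rewrite (norm1_wide (size_poly _ _)) /last_sum.
have leMd : ((M - d).+1 <= M.+1)%N by rewrite ltnS leq_subr.
rewrite [X in _ - X](big_ord_widen M.+1 g leMd).
rewrite [X in _ = X - _](bigID (fun i : 'I_M.+1 => (i < (M - d).+1)%N)) /= addrC addrK.
rewrite [RHS]big_mkcond /=; apply: eq_bigr => i _.
rewrite coef_poly ltn_ord ltnS -ltnNge; case: ifP => _; last exact: normr0.
by rewrite ger0_norm.
Qed.

Lemma size_wronsk_trunc M : (d <= M)%N -> (size (wronsk (trunc (M - d))) <= M)%N.
Proof.
move=> dM; rewrite (leq_trans (size_polyD _ _)) // geq_max; apply/andP; split.
  apply: leq_trans (size_polyMleq _ _) _.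
  have : (size (trunc (M - d))^`() <= M - d)%N.
    have [->|G0] := eqVneq (trunc (M - d)) 0; first by rewrite deriv0 size_poly0.
    by rewrite -ltnS; apply: leq_trans (lt_size_deriv G0) _; apply: size_poly.
  by rewrite -/d; lia.
apply: leq_trans (size_scale_leq _ _) _; apply: leq_trans (size_polyMleq _ _) _.
have := size_poly (M - d).+1 g; rewrite -/(trunc (M - d)).
have [->|D0] := eqVneq D 0; first by rewrite deriv0 size_poly0; lia.
by have := lt_size_deriv D0; rewrite -/d; lia.
Qed.

Definition wronsk_bound := norm1 D + alpha * norm1 D^`().

(** The factor (M + 1) t^M is the derivative of t^(M+1): the
loss of a factor M in norm1_deriv disappears after integration over [0, 1], which
leaves last_sum, the sum of at most size D late terms of g. *)
Lemma norm_wronsk_trunc M t : (d <= M)%N -> 0 <= t <= 1 ->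
  `|(wronsk (trunc M)).[t]| <= wronsk_bound * last_sum M * (M.+1%:R * t ^+ M).
Proof.
move=> dM t01; apply: (@le_trans _ _ (norm1 (wronsk (last_block M)) * t ^+ M)).
  apply: norm_horner_tail => // i; first exact: coef_wronsk_trunc.
  move=> Mi; rewrite trunc_split wronskD coefD nth_default ?add0r //.
  exact: leq_trans (size_wronsk_trunc dM) Mi.
rewrite mulrA ler_wpM2r ?exprn_ge0 //; first by case/andP: t01.
have B0 : 0 <= last_sum M by rewrite -norm1_last_block norm1_ge0.
apply: le_trans (norm1D _ _) _; rewrite /wronsk_bound !mulrDl.
have dB : norm1 (last_block M)^`() <= last_sum M * M.+1%:R.
  apply: le_trans (norm1_deriv _) _; rewrite norm1_last_block mulrC.
  by rewrite ler_wpM2l // ler_nat size_poly.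
apply: lerD.
  apply: le_trans (norm1M _ _) _; rewrite -mulrA.
  by rewrite ler_wpM2l ?norm1_ge0.
apply: le_trans (norm1Z _ _) _; rewrite ger0_norm // -!mulrA ler_wpM2l //.
apply: le_trans (norm1M _ _) _; rewrite norm1_last_block ler_wpM2l ?norm1_ge0 //.
by rewrite ler_peMr // ler1n.
Qed.

End LogDerivative.

(** * From the recursion to the sum of the series *)

Local Open Scope classical_set_scope.

(** Both h - f and h + f are nondecreasing. *)
Lemma ler_dist_derive (R : realType) (f h df dh : R -> R) (x : R) :
  0 <= x ->
  (forall t, t \in `[0, x]%R -> is_derive t 1 f (df t)) ->
  (forall t, t \in `[0, x]%R -> is_derive t 1 h (dh t)) ->
  (forall t, t \in `[0, x]%R -> `|df t| <= dh t) ->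
  `|f x - f 0| <= h x - h 0.
Proof.
move=> x0 Df Dh fh.
have key (e : R -> R) (de : R -> R) :
    (forall t, t \in `[0, x]%R -> is_derive t 1 e (de t)) ->
    (forall t, t \in `[0, x]%R -> 0 <= de t) -> e 0 <= e x.
  move=> De de0.
  have De' t : t \in `]0, x[%R -> is_derive t 1 e (de t).
    by move=> t0x; apply: De; apply: subset_itv_oo_cc.
  have Ce : {within `[0, x], continuous e}.
    by apply: derivable_within_continuous => t /De [].
  have [c cx] := MVT_segment x0 De' Ce.
  by rewrite -subr_ge0 => ->; rewrite subr0 mulr_ge0 // de0.
rewrite ler_norml; apply/andP; split.
  have := key (h \+ f)%R (fun t => dh t + df t).
  have H1 t : t \in `[0, x]%R -> is_derive t 1 (h \+ f)%R (dh t + df t).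
    by move=> tx; have := Df t tx; have := Dh t tx; move=> ? ?; apply: is_deriveD.
  move=> /(_ H1); have H2 t : t \in `[0, x]%R -> 0 <= dh t + df t.
    by move=> /fh; rewrite ler_norml => /andP[]; lra.
  by move=> /(_ H2) /=; lra.
have := key (h \- f)%R (fun t => dh t - df t).
have H1 t : t \in `[0, x]%R -> is_derive t 1 (h \- f)%R (dh t - df t).
  by move=> tx; have := Df t tx; have := Dh t tx; move=> ? ?; apply: is_deriveB.
move=> /(_ H1); have H2 t : t \in `[0, x]%R -> 0 <= dh t - df t.
  by move=> /fh; rewrite ler_norml => /andP[]; lra.
by move=> /(_ H2) /=; lra.
Qed.

Lemma is_derive_ln_horner (R : realType) (p : {poly R}) (t : R) : 0 < p.[t] ->
  is_derive t 1 (fun u => ln p.[u]) (p^`().[t] / p.[t]).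
Proof.
move=> pt; have ? := is_derive_poly p t; have ? := is_derive1_ln pt.
have -> : (fun u => ln p.[u]) = @ln R \o horner p by [].
by apply: (trigger_derive (is_derive1_comp _ _)); rewrite mulrC.
Qed.

(** At the first point where f drops to c / 2, f would
already have been below c at some earlier point, before which it is positive. *)
Lemma pos_of_hereditary_bound (R : realType) (f : R -> R) (c x : R) :
  continuous f -> 0 < c -> 0 < f 0 ->
  (forall y, 0 <= y <= 1 -> (forall t, 0 <= t <= y -> 0 < f t) -> c <= f y) ->
  0 <= x <= 1 -> 0 < f x.
Proof.
move=> cf c0 f0 fc x01; rewrite ltNge; apply/negP => fx.
pose Z := `[0, 1] `&` f @^-1` [set y | y <= c / 2].
have cZ : compact Z.
  apply: (subclosed_compact _ (@segment_compact R 0 1)); last by move=> t [].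
  apply: closedI; first exact: interval_closed.
  apply: preimage_closed => [t _|]; first exact: cf.
  exact: closed_le.
have Z0 : Z !=set0.
  exists x; split; rewrite /= ?in_itv //=.
  by apply: le_trans fx _; rewrite divr_ge0 // ltW.
have [] := @compact_EVT_min _ _ id Z Z0 cZ.
  by apply: continuous_subspaceT => t; apply: cvg_id.
move=> t0; rewrite inE => -[/= ]; rewrite in_itv /= => /andP[t00 t01] ft0 minZ.
have above t : 0 <= t < t0 -> c / 2 < f t.
  move=> /andP[t_ge0 tt0]; rewrite ltNge; apply/negP => ft.
  have := minZ t; rewrite leNgt tt0 => /(_ _)/negP; apply => //.
  by rewrite inE; split => //=; rewrite in_itv /= t_ge0 (le_trans (ltW tt0)).
have cf0 : c <= f 0.
  by apply: fc; rewrite ?lexx ?ler01 // => t /le_anti <-.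
(* a value strictly between c / 2 and c is attained before t0, where f is
   still positive *)
have : exists2 t, t \in `[0, t0]%R & f t = 3 / 4 * c.
  apply: IVT => //; first exact/continuous_subspaceT.
  apply/andP; split; rewrite ?ge_min ?le_max; apply/orP.
    by right; lra.
  by left; lra.
move=> [t]; rewrite in_itv /= => /andP[t_ge0 tt0] ft.
have tlt : t < t0.
  rewrite lt_neqAle tt0 andbT; apply/eqP => e; move: ft0; rewrite /= -e ft; lra.
have : c <= f t.
  apply: fc => [|u /andP[u0 ut]]; first by rewrite t_ge0 (le_trans tt0).
  by apply: lt_trans (above u _); [lra|rewrite u0 (le_lt_trans ut)].
by rewrite ft; lra.
Qed.

Section PowerSeries.
Variables (R : realType) (alpha : R) (D : {poly R}) (g tau : nat -> R).
Hypothesis alpha_gt0 : 0 < alpha.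
Hypothesis g0 : g 0 = 1.
Hypothesis g_ge0 : forall i, 0 <= g i.
Hypothesis g_rec : forall N,
  N.+1%:R * g N.+1 = alpha * \sum_(i < N.+1) tau i * g (N - i)%N.
Hypothesis D0 : D.[0] = 1.
Hypothesis D_rec : forall N i, (i < N)%N ->
  D^`()`_i = - (D * \poly_(k < N) tau k)`_i.
Hypothesis g_cvg : cvgn (series g).

Let S := limn (series g).

Lemma trunc_ge1 M (x : R) : 0 <= x -> 1 <= (trunc g M).[x].
Proof.
move=> x0; rewrite horner_poly big_ord_recl g0 expr0 mulr1 lerDl.
by apply: sumr_ge0 => i _; rewrite mulr_ge0 ?exprn_ge0.
Qed.

Lemma trunc1E M : (trunc g M).[1] = series g M.+1.
Proof.
rewrite horner_poly /series /= big_mkord.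
by apply: eq_bigr => i _; rewrite expr1n mulr1.
Qed.

Lemma series_le_lim M : series g M <= S.
Proof.
apply: nondecreasing_cvgn_le => //; apply: nondecreasing_series => i _ _.
exact: g_ge0.
Qed.

Lemma trunc_le_lim M (x : R) : 0 <= x <= 1 -> (trunc g M).[x] <= S.
Proof.
move=> /andP[x0 x1]; apply: le_trans (series_le_lim M.+1); rewrite -trunc1E.
rewrite !horner_poly; apply: ler_sum => i _; rewrite ler_wpM2l // expr1n.
by rewrite exprn_ile1.
Qed.

(** A difference of two partial sums of the same convergent series. *)
Lemma last_sum_cvg : last_sum D g M @[M --> \oo] --> (0 : R).
Proof.
rewrite -[X in _ --> X](subrr S).
have E : last_sum D g = (fun M => series g M.+1 - series g (M - size D).+1).
  by apply/funext => M; rewrite /last_sum /series /= !big_mkord.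
rewrite E; apply: cvgB; first by rewrite (cvg_shiftS (series g)).
rewrite -(cvg_shiftn (size D)) /=.
rewrite (_ : (fun n => _) = [sequence series g n.+1]_n); last first.
  by apply/funext => n /=; rewrite addnK.
by rewrite (cvg_shiftS (series g)).
Qed.

(** The quantity inside the norm vanishes at 0, and its derivative is
wronsk (trunc g M) divided by the product of trunc g M, which is at least 1, and D, which is at least delta. *)
Lemma log_estimate M (x delta : R) : (size D <= M)%N -> 0 <= x <= 1 ->
  0 < delta -> (forall t, 0 <= t <= x -> delta <= D.[t]) ->
  `|ln (trunc g M).[x] + alpha * ln D.[x]| <=
    wronsk_bound alpha D / delta * last_sum D g M.
Proof.
move=> dM /andP[x0 x1] delta0 Ddelta; pose G := trunc g M.
pose K := wronsk_bound alpha D / delta * last_sum D g M.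
have K0 : 0 <= K.
  rewrite mulr_ge0 //; last by rewrite -norm1_last_block // norm1_ge0.
  by rewrite divr_ge0 ?addr_ge0 ?mulr_ge0 ?norm1_ge0 // ltW.
pose f t := ln G.[t] + alpha * ln D.[t].
pose df t := G^`().[t] / G.[t] + alpha * (D^`().[t] / D.[t]).
(* h' dominates |f'| on [0, x], and h x <= K *)
pose h : {poly R} := K *: 'X^(M.+1).
have Gt t : t \in `[0, x]%R -> 1 <= G.[t].
  by rewrite in_itv => /andP[t0 _]; apply: trunc_ge1.
have Dt t : t \in `[0, x]%R -> delta <= D.[t] by rewrite in_itv; apply: Ddelta.
have G00 : G.[0] = 1.
  rewrite horner_poly big_ord_recl g0 expr0 mulr1 big1 ?addr0 // => i _.
  by rewrite expr0n mulr0.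
have := @ler_dist_derive R f (horner h) df (horner h^`()) x x0.
rewrite /f G00 D0 ln1 mulr0 addr0 subr0 => /(_ _ _ _)/le_trans; apply.
- move=> t tx; have Gp : 0 < G.[t] by apply: lt_le_trans (Gt t tx).
  have Dp : 0 < D.[t] by apply: lt_le_trans (Dt t tx).
  have ? := is_derive_ln_horner Gp; have ? := is_derive_ln_horner Dp.
  by apply: trigger_derive.
- move=> t tx; have Gp : 0 < G.[t] by apply: lt_le_trans (Gt t tx).
  have Dp : 0 < D.[t] by apply: lt_le_trans (Dt t tx).
  have -> : df t = (wronsk alpha D G).[t] / (G.[t] * D.[t]).
    rewrite /df /wronsk !(hornerD, hornerM, hornerZ); field.
    by rewrite !gt_eqF.
  have t01 : 0 <= t <= 1.
    by move: tx; rewrite in_itv /= => /andP[-> tx]; apply: le_trans tx x1.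
  rewrite normrM normfV (gtr0_norm (mulr_gt0 Gp Dp)).
  rewrite ler_pdivrMr ?mulr_gt0 //.
  apply: le_trans (norm_wronsk_trunc _ _ g_rec D_rec dM t01) _ => //; first exact: ltW.
  rewrite /h derivZ derivXn hornerZ hornerMn hornerXn /K /=.
  rewrite -[X in K * X]mulr_natl.
  have -> : wronsk_bound alpha D * last_sum D g M * (M.+1%:R * t ^+ M) =
    K * (M.+1%:R * t ^+ M) * delta by rewrite /K; field; rewrite gt_eqF.
  rewrite ler_wpM2l //.
    by rewrite mulr_ge0 // mulr_ge0 // exprn_ge0 //; case/andP: t01.
  by rewrite -[delta]mul1r ler_pM ?Gt ?Dt // ltW.
- rewrite /h !hornerZ !hornerXn expr0n mulr0 subr0 ler_piMr //.
  by rewrite exprn_ile1.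
Qed.

Lemma log_trunc_cvg (x : R) : 0 <= x <= 1 ->
  (forall t, 0 <= t <= x -> 0 < D.[t]) ->
  ln (trunc g M).[x] @[M --> \oo] --> - (alpha * ln D.[x]).
Proof.
move=> x01 Dpos.
have [delta delta0 Ddelta] : exists2 delta, 0 < delta &
    forall t, 0 <= t <= x -> delta <= D.[t].
  have [|c cx minD] := @EVT_min R (horner D) 0 x (proj1 (andP x01)).
    exact/continuous_subspaceT/continuous_horner.
  by exists D.[c]; [apply: Dpos; rewrite in_itv in cx|
    move=> t tx; apply: minD; rewrite in_itv].
have lim0 : wronsk_bound alpha D / delta * last_sum D g M @[M --> \oo] --> (0 : R).
  rewrite -[X in _ --> X](mulr0 (wronsk_bound alpha D / delta)).
  by apply: cvgM; [apply: cvg_cst|apply: last_sum_cvg].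
apply/subr_cvg0/norm_cvg0P.
apply: (squeeze_cvgr _ (cvg_cst (0 : R)) lim0).
exists (size D) => // M dM; rewrite normr_ge0 opprK /=.
exact: log_estimate.
Qed.

(** If D is positive on [0, y], then - alpha ln D(y) is the limit of
the logarithms of truncations that are at most S, so D(y) >= S^(- 1 / alpha). *)
Lemma fredholm_gt0 (x : R) : 0 <= x <= 1 -> 0 < D.[x].
Proof.
apply: (pos_of_hereditary_bound (@continuous_horner _ D)
  (expR_gt0 (- (ln S / alpha)))) => [|y y01 Dpos]; first by rewrite D0.
have Dy : 0 < D.[y] by apply: Dpos; rewrite lexx andbT; case/andP: y01.
have S1 : 0 < S.
  apply: lt_le_trans (trunc_le_lim 0 y01).
  by apply: lt_le_trans (trunc_ge1 0 _) => //; case/andP: y01.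
have L : - (alpha * ln D.[y]) <= ln S.
  apply: (cvgr_to_le (log_trunc_cvg y01 Dpos)).
  apply: nearW => M; rewrite ler_ln ?posrE ?trunc_le_lim //.
  by apply: lt_le_trans (trunc_ge1 M _) => //; case/andP: y01.
rewrite -[leRHS](lnK Dy) ler_expR lerNl ler_pdivlMr // mulrC mulrN.
exact: L.
Qed.

(** The relation G D^alpha = 1 at the point 1, obtained from
log_trunc_cvg by exponentiation. *)
Lemma series_cvg_powR : series g @ \oo --> (D.[1] `^ alpha)^-1.
Proof.
have D1 : 0 < D.[1] by apply: fredholm_gt0; rewrite ler01 lexx.
have -> : (D.[1] `^ alpha)^-1 = expR (- (alpha * ln D.[1])).
  by rewrite expRN /powR gt_eqF.
rewrite -cvg_shiftS.
have -> : [sequence series g M.+1]_M = expR \o (fun M => ln (trunc g M).[1]).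
  apply/funext => M /=; rewrite lnK ?trunc1E // posrE -trunc1E.
  exact: lt_le_trans (trunc_ge1 M _).
apply: continuous_cvg; first exact: continuous_expR.
apply: log_trunc_cvg => [|t t01]; first by rewrite ler01 lexx.
exact: fredholm_gt0.
Qed.

End PowerSeries.

(** * Words, multi-indices and blow-ups *)

Section Histogram.
Variable n : nat.

Definition hist N (t : N.-tuple 'I_n) : n.-tuple nat :=
  [tuple count_mem i t | i < n].

Lemma sum_hist N (t : N.-tuple 'I_n) : \sum_i tnth (hist t) i = N.
Proof.
rewrite -[RHS](size_tuple t) -sum1_size.
rewrite [RHS](partition_big id xpredT) //=; apply: eq_bigr => i _.
by rewrite tnth_mktuple -sum1_count; apply: eq_bigl.
Qed.

Lemma big_block_index (V : Type) (idx : V) (op : Monoid.com_law idx)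
    (k : n.-tuple nat) (F : 'I_n -> V) :
  \big[op/idx]_(m < \sum_i tnth k i) F (block_index m) =
  \big[op/idx]_(i < n) \big[op/idx]_(l < tnth k i) F i.
Proof.
rewrite (reindex (@tagnat.rank n (tnth k))); last exact: tagnat.rank_bij_on.
rewrite (@sig_big_dep _ _ _ _ _ xpredT (fun _ => xpredT) (fun i _ => F i)) /=.
apply: eq_bigr => p _.
by rewrite /block_index tagnat.rankE tagnat.Rank1K.
Qed.

Definition block_tuple (k : n.-tuple nat) : (\sum_i tnth k i)%N.-tuple 'I_n :=
  [tuple block_index m | m < (\sum_i tnth k i)%N].

Lemma hist_block_tuple k : hist (block_tuple k) = k.
Proof.
apply: eq_from_tnth => i; rewrite tnth_mktuple -sum1_count big_map big_enum_cond.
rewrite big_mkcond /=.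
rewrite (big_block_index _ k (fun j => if j == i then 1%N else 0%N)).
rewrite (bigD1 i) //= eqxx big_const_ord iter_addn_0 mul1n big1 ?addn0 // => j ji.
by rewrite (negPf ji) big_const_ord iter_addn_0.
Qed.

Lemma perm_eq_hist N N' (t : N.-tuple 'I_n) (t' : N'.-tuple 'I_n) :
  hist t = hist t' -> perm_eq t t'.
Proof.
move=> e; apply/allP => i _; apply/eqP.
by have := congr1 (fun k => tnth k i) e; rewrite !tnth_mktuple.
Qed.

(** The histogram of a word after one letter a is deleted. *)
Definition decr (a : 'I_n) (k : n.-tuple nat) : n.-tuple nat :=
  [tuple (tnth k i - (i == a))%N | i < n].

Lemma hist_cons N a (t : N.-tuple 'I_n) k :
  (hist (cons_tuple a t) == k) = (0 < tnth k a)%N && (hist t == decr a k).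
Proof.
apply/eqP/andP => [<-|[k0 /eqP/(congr1 (fun k' => tnth k' _)) e]].
  split; first by rewrite tnth_mktuple /= eqxx.
  apply/eqP/eq_from_tnth => i; rewrite !tnth_mktuple /= eq_sym.
  by rewrite addKn.
apply: eq_from_tnth => i; have := e i; rewrite !tnth_mktuple /= => ->.
by rewrite eq_sym; case: eqVneq => [->|_]; rewrite ?subnKC ?subn0.
Qed.

Lemma sum_decr a k : (0 < tnth k a)%N ->
  (\sum_i tnth (decr a k) i).+1 = (\sum_i tnth k i)%N.
Proof.
move=> k0; rewrite (bigD1 a) //= [RHS](bigD1 a) //= tnth_mktuple eqxx -addSn.
rewrite subn1 prednK //; congr addn; apply: eq_bigr => i ia.
by rewrite tnth_mktuple (negPf ia) subn0.
Qed.

Lemma prod_fact_decr a k : (0 < tnth k a)%N ->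
  (\prod_i (tnth k i)`! = tnth k a * \prod_i (tnth (decr a k) i)`!)%N.
Proof.
move=> k0; rewrite (bigD1 a) //= [in RHS](bigD1 a) //= tnth_mktuple eqxx mulnA.
rewrite subn1; case: (tnth k a) k0 => // c _; congr (_ * _)%N.
by apply: eq_bigr => i ia; rewrite tnth_mktuple (negPf ia) subn0.
Qed.

(** The multinomial count of the words with a given histogram, by
deletion of the first letter. *)
Lemma card_hist N k : (\sum_i tnth k i)%N = N ->
  ((\sum_(t : N.-tuple 'I_n) (hist t == k)) * \prod_i (tnth k i)`! = N`!)%N.
Proof.
elim: N k => [|N IHN] k kN.
  have k0 i : tnth k i = 0%N by move/eqP: kN; rewrite sum_nat_eq0 => /forallP/(_ i)/eqP.
  rewrite (big_pred1 [tuple]) => [|t]; last by rewrite [t]tuple0 /=; apply/esym/eqP.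
  rewrite big1 => [|i _]; last by rewrite k0.
  have -> : hist [tuple] = k; last by rewrite eqxx.
  by apply: eq_from_tnth => i; rewrite tnth_mktuple k0.
rewrite big_tuple_cons big_distrl /= factS -[X in (X * _)%N]kN big_distrl /=.
apply: eq_bigr => a _; have [k0|ka] := posnP (tnth k a).
  rewrite k0 big1 // => t _.
  by rewrite hist_cons k0.
rewrite (eq_bigr (fun t => (hist t == decr a k) : nat)) => [|t _]; last first.
  by rewrite hist_cons ka.
rewrite (prod_fact_decr ka) mulnCA IHN //.
by apply/succn_inj; rewrite sum_decr.
Qed.

(** The multi-indices k with |k| = N, without repetition; they are
enumerated as the histograms of the words of length N. *)
Definition levels N : seq (n.-tuple nat) :=
  undup [seq hist t | t : N.-tuple 'I_n].

Lemma mem_levels N k : (k \in levels N) = (\sum_i tnth k i == N)%N.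
Proof.
rewrite mem_undup; apply/mapP/eqP => [[t _ ->]|<-]; first exact: sum_hist.
by exists (block_tuple k); rewrite ?mem_enum ?hist_block_tuple.
Qed.

Variables (R : realType) (alpha : R) (C : 'M[R]_n).

Definition wordmx N (t : N.-tuple 'I_n) : 'M[R]_N :=
  \matrix_(p, q) C (tnth t p) (tnth t q).

Lemma alpha_perm_wordmx_perm N N' (t : N.-tuple 'I_n) (t' : N'.-tuple 'I_n) :
  perm_eq t t' -> alpha_perm alpha (wordmx t) = alpha_perm alpha (wordmx t').
Proof.
move=> tt'; have NN' : N' = N.
  by have := perm_size tt'; rewrite !size_tuple.
move: t' tt'; rewrite NN' => t' /tuple_permP [s es].
have -> : t = [tuple tnth t' (s i) | i < N] by apply: val_inj.
rewrite -[RHS](alpha_perm_conj _ _ s); congr alpha_perm; apply/matrixP => p q.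
by rewrite !mxE !tnth_mktuple.
Qed.

(** Two words with the same histogram differ by a
permutation of their positions, which conjugates the permutations of the sum; the
blow-up along k is the word that lists the letters in increasing order. *)
Lemma alpha_perm_blowup_hist N (t : N.-tuple 'I_n) :
  alpha_perm alpha (blowup C (hist t)) = alpha_perm alpha (wordmx t).
Proof.
rewrite -[RHS](alpha_perm_wordmx_perm (t := block_tuple (hist t))).
  by congr alpha_perm; apply/matrixP => p q; rewrite !mxE !tnth_mktuple.
by apply: perm_eq_hist; rewrite hist_block_tuple.
Qed.

Lemma alpha_coef_levels N : alpha_coef alpha C N =
  \sum_(k <- levels N) alpha_perm alpha (blowup C k) / \prod_i ((tnth k i)`!)%:R.
Proof.
rewrite /alpha_coef /word_sum.
transitivity (\sum_(t : N.-tuple 'I_n) \sum_(k <- levels N)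
    (hist t == k)%:R * (alpha_perm alpha (blowup C k) / N`!%:R)).
  rewrite mulr_suml; apply: eq_bigr => t _.
  rewrite (bigD1_seq (hist t)) ?undup_uniq ?mem_levels ?sum_hist //=.
  rewrite eqxx mul1r [X in _ + X]big1 => [|k kt].
    by rewrite addr0 alpha_perm_blowup_hist.
  by rewrite eq_sym (negPf kt) mul0r.
rewrite exchange_big /= big_seq [RHS]big_seq; apply: eq_bigr => k.
rewrite mem_levels => /eqP kN; rewrite -mulr_suml -natr_sum -natr_prod.
set c := (\sum_t _)%N; set f := (\prod_i _)%N.
have cf : c%:R * f%:R = N`!%:R :> R by rewrite -natrM card_hist.
have : N`!%:R != 0 :> R by rewrite pnatr_eq0 -lt0n fact_gt0.
rewrite -cf mulf_eq0 negb_or => /andP[c0 f0].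
by field; rewrite c0 f0.
Qed.

End Histogram.

(** * The master identity for nonnegative matrices *)

Section Scaling.
Variables (R : realType) (n : nat) (alpha : R).

(** Along any permutation each column of the blow-up
is used once, and the column index i is repeated k_i times. *)
Lemma alpha_perm_blowup_scale (B : 'M[R]_n) (e : 'rV[R]_n) k :
  alpha_perm alpha (blowup (B *m diag_mx e) k) =
  \prod_i e 0 i ^+ tnth k i * alpha_perm alpha (blowup B k).
Proof.
rewrite /alpha_perm mulr_sumr; apply: eq_bigr => s _.
rewrite mulrCA; congr (_ * _).
have -> : \prod_i e 0 i ^+ tnth k i = \prod_p e 0 (block_index (s p)).
  rewrite -(reindex_inj (@perm_inj _ s)
    (F := fun p => e 0 (block_index p)) (P := xpredT)) /=.
  rewrite (big_block_index _ k (fun i => e 0 i)).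
  by apply: eq_bigr => i _; rewrite prodr_const card_ord.
rewrite -big_split /=; apply: eq_bigr => p _.
by rewrite mxE mul_mx_diag !mxE mulrC.
Qed.

Lemma alpha_perm_ge0 N (M : 'M[R]_N) : 0 <= alpha ->
  (forall i j, 0 <= M i j) -> 0 <= alpha_perm alpha M.
Proof.
move=> a0 M0; apply: sumr_ge0 => s _.
by rewrite mulr_ge0 ?exprn_ge0 // prodr_ge0.
Qed.

Lemma alpha_perm_le N (M M' : 'M[R]_N) : 0 <= alpha ->
  (forall i j, 0 <= M i j <= M' i j) -> alpha_perm alpha M <= alpha_perm alpha M'.
Proof.
move=> a0 MM'; apply: ler_sum => s _.
by rewrite ler_wpM2l ?exprn_ge0 // ler_prod.
Qed.

Lemma alpha_coef_ge0 (C : 'M[R]_n) N : 0 <= alpha ->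
  (forall i j, 0 <= C i j) -> 0 <= alpha_coef alpha C N.
Proof.
move=> a0 C0; rewrite divr_ge0 //; apply: sumr_ge0 => t _.
by apply: alpha_perm_ge0 => // i j; rewrite mxE.
Qed.

Lemma alpha_coef_le (C C' : 'M[R]_n) N : 0 <= alpha ->
  (forall i j, 0 <= C i j <= C' i j) -> alpha_coef alpha C N <= alpha_coef alpha C' N.
Proof.
move=> a0 CC'; rewrite ler_wpM2r ?invr_ge0 //; apply: ler_sum => t _.
by apply: alpha_perm_le => // i j; rewrite !mxE.
Qed.

(** The case of nonnegative matrices of the MacMahon master
theorem for alpha-permanents.  Convergence of the series is a hypothesis: it
forces det (1 - C) > 0. *)
Lemma alpha_perm_master (C : 'M[R]_n) : 0 < alpha ->
  (forall i j, 0 <= C i j) -> cvgn (series (alpha_coef alpha C)) ->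
  series (alpha_coef alpha C) @ \oo --> ((\det (1%:M - C)) `^ alpha)^-1.
Proof.
move=> a0 C0 cC.
have -> : \det (1%:M - C) = (fredholm C).[1] by rewrite horner_fredholm scale1r.
apply: (@series_cvg_powR R alpha _ _ (fun i => \tr (C ^+ i.+1))) => //.
- exact: alpha_coef0.
- by move=> i; apply: alpha_coef_ge0 => //; apply: ltW.
- exact: alpha_coef_rec.
- by rewrite horner_fredholm scale0r subr0 det1.
- exact: coef_deriv_fredholm.
Qed.

End Scaling.

(** * Entries of a normalized M-matrix *)

Section MMatrix.
Variables (R : realType) (n : nat) (A : 'M[R]_n).
Hypothesis hA : nonsingular_Mmatrix A.

(** In the diagonal entry 1 of A A^-1 all the terms but
A i i * (A^-1) i i are nonpositive. *)
Lemma Mmatrix_diag_gt0 i : 0 < A i i.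
Proof.
case: hA => offA Aunit invA.
have := congr1 (fun M : 'M[R]_n => M i i) (mulmxV Aunit).
rewrite !mxE eqxx (bigD1 i) //= => e.
have s0 : \sum_(j | j != i) A i j * invmx A j i <= 0.
  by apply: sumr_le0 => j ji; rewrite mulr_le0_ge0 // offA // eq_sym.
have p : 0 < A i i * invmx A i i by move: e s0 => /=; lra.
rewrite ltNge; apply/negP => Aii; move: p; rewrite ltNge => /negP; apply.
by rewrite mulr_le0_ge0.
Qed.

Lemma normalize_off_ge0 i j : 0 <= normalize_off A i j.
Proof.
have Du : diag_part A \in unitmx.
  rewrite unitmxE det_diag unitfE; apply/prodf_neq0 => k _.
  by rewrite mxE gt_eqF // Mmatrix_diag_gt0.
have := congr1 (fun M : 'M[R]_n => M i j) (mulKVmx Du (off_part A)).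
rewrite -[invmx _ *m _]/(normalize_off A) /diag_part mul_diag_mx !mxE => e.
rewrite -(pmulr_rge0 _ (Mmatrix_diag_gt0 i)) e.
have [->|ij] := eqVneq i j; first by rewrite mulr1n subrr.
by rewrite mulr0n sub0r oppr_ge0; case: hA => + _ _; apply.
Qed.

End MMatrix.

(** * Expectations along the levels of the multi-index *)

Section Distribution.
Variables (d : measure_display) (T : measurableType d) (R : realType).
Variables (P : probability T R) (n : nat) (Z : {RV P >-> n.-tuple nat}).
Local Open Scope ereal_scope.

Lemma measurable_fiber (k : n.-tuple nat) : measurable (Z @^-1` [set k]).
Proof.
rewrite -[_ @^-1` _]setTI; apply: (measurable_funPT Z) => //.
have -> : [set k] = \bigcap_(i in [set: 'I_n]) ((@tnth n nat ^~ i) @^-1` [set tnth k i]).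
  apply/seteqP; split=> [t -> //|t tk]; apply: eq_from_tnth => i.
  exact: tk.
apply: fin_bigcap_measurable => [|i _]; first exact: finite_finset.
by rewrite -[_ @^-1` _]setTI; apply: (measurable_tnth i).
Qed.

(** The event that the coordinates of Z add up to N, written as a
finite union of fibers (see level_eventE) so that integrals over it split. *)
Definition level_event N : set T :=
  \big[setU/set0]_(k <- levels n N) (Z @^-1` [set k]).

Lemma level_eventE N : level_event N = [set w | (\sum_i tnth (Z w) i)%N = N].
Proof.
rewrite /level_event -bigcup_seq; apply/seteqP; split=> w /=.
  by move=> [k] /=; rewrite mem_levels => /eqP kN /= ->.
by move=> /eqP wN; exists (Z w) => //=; rewrite mem_levels.
Qed.

(** Every preimage is a countable union of fibers of Z. *)
Lemma measurable_fun_discrete (f : n.-tuple nat -> R) :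
  measurable_fun setT (f \o Z).
Proof.
move=> _ B mB; rewrite setTI.
have -> : (f \o Z) @^-1` B =
    \bigcup_N \big[setU/set0]_(k <- levels n N | f k \in B) (Z @^-1` [set k]).
  apply/seteqP; split=> w /=.
    move=> fB; exists (\sum_i tnth (Z w) i)%N => //.
    rewrite -bigcup_seq_cond; exists (Z w) => //=.
    by rewrite mem_levels eqxx; apply/mem_set.
  move=> [N _]; rewrite -bigcup_seq_cond => -[k /= /andP[_ /set_mem fk]] /= ->.
  exact: fk.
apply: bigcup_measurable => N _; apply: bigsetU_measurable => k _.
exact: measurable_fiber.
Qed.

Lemma ge0_expectation_levels (f : n.-tuple nat -> R) :
  (forall k, (0 <= f k)%R) ->
  'E_P[f \o Z] =
  \sum_(N <oo) \sum_(k <- levels n N) (f k)%:E * distribution P Z [set k].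
Proof.
move=> f0; rewrite unlock.
have mf D : measurable_fun D (EFin \o (f \o Z)).
  apply: measurable_funTS; apply/measurable_EFinP.
  exact: measurable_fun_discrete.
have UE : [set: T] = \bigcup_N level_event N.
  apply/esym/seteqP; split => // w _; exists (\sum_i tnth (Z w) i)%N => //.
  by rewrite level_eventE.
rewrite UE ge0_integral_bigcup //.
- apply: eq_eseriesr => N _; rewrite /level_event ge0_integral_bigsetU //.
  + apply: eq_bigr => k _; transitivity (\int[P]_(w in Z @^-1` [set k]) (f k)%:E).
      by apply: eq_integral => w /set_mem /= ->.
    by rewrite integral_cst //; apply: measurable_fiber.
  + exact: measurable_fiber.
  + exact: undup_uniq.
  + by move=> k k' _ _ [w [/= <- <-]].
  + by move=> w _; rewrite lee_fin; apply: f0.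
- by move=> N; apply: bigsetU_measurable => k _; apply: measurable_fiber.
- by move=> w _; rewrite lee_fin; apply: f0.
- by move=> N N' _ _ [w []]; rewrite !level_eventE => /= <- <-.
Qed.

End Distribution.

(** * The Laplace transform *)

Theorem lemma1p2 (R : realType) (n : nat) (alpha : R) (halpha : 0 < alpha)
    (A : 'M[R]_n) (hA : nonsingular_Mmatrix A)
    (d : measure_display) (T : measurableType d) (P : probability T R)
    (Z : {RV P >-> n.-tuple nat})
    (hZ : forall k : n.-tuple nat,
        distribution P Z [set k] = (Z_mass alpha A k)%:E)
    (s : 'I_n -> R) (hs : forall i, 0 <= s i) :
  ('E_P[fun w => expR (- \sum_(i < n) s i * (tnth (Z w) i)%:R)] =
   ((\det (normalize A)) `^ alpha /
    (\det (1%:M - normalize_off A *m exp_diag s)) `^ alpha)%:E)%E.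
Proof.
set c := _ `^ alpha; pose B := normalize_off A.
have a0 := ltW halpha.
have B0 := normalize_off_ge0 hA; rewrite -/B in B0.
pose C u : 'M[R]_n := B *m exp_diag u.
have CE u i j : C u i j = B i j * expR (- u j).
  by rewrite /C /exp_diag mul_mx_diag !mxE.
have C0 u i j : 0 <= C u i j by rewrite CE mulr_ge0 ?expR_ge0.
have key u : ('E_P[fun w => expR (- \sum_(i < n) u i * (tnth (Z w) i)%:R)] =
    \sum_(N <oo) (c * alpha_coef alpha (C u) N)%:E)%E.
  pose f (k : n.-tuple nat) := expR (- \sum_(i < n) u i * (tnth k i)%:R).
  have f0 k : 0 <= f k by apply: expR_ge0.
  rewrite -[LHS]/('E_P[f \o Z])%E ge0_expectation_levels //.
  apply: eq_eseriesr => N _; rewrite alpha_coef_levels mulr_sumr -sumEFin.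
  apply: eq_bigr => k _; rewrite hZ -EFinM /Z_mass -/c -/B; congr (_%:E).
  rewrite alpha_perm_blowup_scale.
  have -> : f k = \prod_i (\row_j expR (- u j)) 0 i ^+ tnth k i.
    rewrite /f -sumrN expR_sum; apply: eq_bigr => i _.
    by rewrite mxE -mulNr mulrC expRM_natl.
  by rewrite mulrCA !mulrA.
have total : (\sum_(N <oo) (c * alpha_coef alpha (C (fun=> 0)) N)%:E = 1)%E.
  rewrite -key (_ : (fun w => _) = cst 1) ?expectation_cst //.
  apply/funext => w; rewrite big1 ?oppr0 ?expR0 // => i _.
  by rewrite mul0r.
(* the masses add up to 1, so they cannot all vanish *)
have c_gt0 : 0 < c.
  rewrite lt_neqAle powR_ge0 andbT; apply/eqP => c0; move: total.
  under eq_eseriesr do rewrite -c0 mul0r.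
  rewrite eseries0 // => /eqP.
  by rewrite eq_sym onee_eq0.
(* the coefficients for s are dominated by those for 0, whose sum is 1 / c *)
have cvg0 : cvgn (series (alpha_coef alpha (C s))).
  apply: nondecreasing_is_cvgn.
    by apply: nondecreasing_series => N _ _; apply: alpha_coef_ge0.
  exists c^-1 => _ [N _ <-].
  rewrite -[leRHS]mulr1 ler_pdivlMl // -lee_fin -total.
  apply: le_trans (nneseries_lim_ge N _); last first.
    by move=> i _ _; rewrite lee_fin mulr_ge0 ?(ltW c_gt0) // alpha_coef_ge0.
  rewrite sumEFin lee_fin /series /= mulr_sumr; apply: ler_sum => i _.
  rewrite ler_wpM2l ?(ltW c_gt0) //; apply: alpha_coef_le => // p q.
  rewrite C0 !CE oppr0 expR0 ler_wpM2l //.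
  by rewrite -expR0 ler_expR oppr_le0.
rewrite key; have limC := alpha_perm_master halpha (C0 s) cvg0.
apply: cvg_lim => //.
rewrite (_ : (fun N => _) = EFin \o (fun N => c * series (alpha_coef alpha (C s)) N)).
  apply: cvg_EFin; first exact: nearW.
  by apply: cvgM => //; apply: cvg_cst.
by apply/funext => N /=; rewrite sumEFin mulr_sumr.
Qed.
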